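(* Let $(\mathcal A,\varphi,\mathcal F,\Phi)$ be a ncps of type B$'$ with associated infinitesimal ncps $(\mathcal B,\varphi,\varphi')$. Let $(\mathcal A_i)_{i\in I}$ be subalgebras of $\mathcal A$ containing $1_{\mathcal A}$ and $(\mathcal F_j)_{j\in J}$ subalgebras of $\mathcal F$; set $\mathcal A_i':=\mathcal A_i\oplus\{0_{\mathcal F}\}\subseteq\mathcal B$ and $\mathcal F_j':=\mathbb C1_{\mathcal A}\oplus\mathcal F_j\subseteq\mathcal B$. Then: (A) $((\mathcal A_i)_{i\in I},(\mathcal F_j)_{j\in J})$ is B$'$-free in $(\mathcal A,\varphi,\mathcal F,\Phi)$ if and only if the subalgebras $\mathcal A_i'$ ($i\in I$), $\mathcal F_j'$ ($j\in J$) are infinitesimally free in $(\mathcal B,\varphi,\varphi')$. (B) Let $\mathcal F':=\mathbb C1_{\mathcal A}\oplus\langle\mathcal F_j: j\in J\rangle$ (where $\langle\mathcal F_j:j\in J\rangle$ is the subalgebra of $\mathcal F$ generated by all $\mathcal F_j$). Then $((\mathcal A_i)_{i\in I},(\mathcal F_j)_{j\in J})$ is weakly B$'$-free in $(\mathcal A,\varphi,\mathcal F,\Phi)$ if and only if the subalgebras $\mathcal A_i'$ ($i\in I$) and $\mathcal F'$ are infinitesimally free in $(\mathcal B,\varphi,\varphi')$.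
   Context: Ncps of type B$'$ $(\mathcal A,\varphi,\mathcal F,\Phi)$: $\mathcal A$ unital complex algebra, $\varphi:\mathcal A\to\mathbb C$ linear with $\varphi(1_{\mathcal A})=1$, $\mathcal F$ an algebra which is an $\mathcal A$-bimodule compatible with its multiplication, $\Phi:\mathcal F\to\mathbb C$ linear. $\mathcal B=\mathcal A\oplus\mathcal F$ with product $(a_1,f_1)(a_2,f_2)=(a_1a_2,a_1f_2+f_1a_2+f_1f_2)$ and unit $1_{\mathcal A}$; $\varphi(a+f):=\varphi(a)$, $\varphi'(a+f):=\Phi(f)$. Freeness of unital subalgebras $(\mathcal A_i)$ w.r.t. $\varphi$: $\varphi(c_1\cdots c_n)=0$ whenever $i_1\ne i_2\ne\cdots\ne i_n$, $c_l\in\mathcal A_{i_l}$, $\varphi(c_l)=0$. Cyclic-antimonotone independence of $(\mathcal A_0,\mathcal F_0)$: $\Phi(c_0g_1c_1\cdots c_{n-1}g_nc_n)=\varphi(c_0c_n)\prod_{l=1}^{n-1}\varphi(c_l)\,\Phi(g_1\cdots g_n)$ for all $n\ge1$, $c_l\in\mathcal A_0$, $g_l\in\mathcal F_0$. Trivial independence of $(\mathcal F_j)$: $\Phi(g_1\cdots g_n)=0$ whenever $n\ge2$, $j_1\ne\cdots\ne j_n$, $g_l\in\mathcal F_{j_l}$. $((\mathcal A_i),(\mathcal F_j))$ is weakly B$'$-free if $(\mathcal A_i)$ are free w.r.t. $\varphi$ and (algebra generated by all $\mathcal A_i$, algebra generated by all $\mathcal F_j$) is cyclic-antimonotone independent;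 it is B$'$-free if in addition $(\mathcal F_j)$ are trivially independent. Infinitesimal freeness of unital subalgebras $(\mathcal B_k)$ of $(\mathcal B,\varphi,\varphi')$: for $k_1\ne k_2\ne\cdots\ne k_n$ and $b_l\in\mathcal B_{k_l}$ with $\varphi(b_l)=0$, $\varphi(b_1\cdots b_n)=0$ and $\varphi'(b_1\cdots b_n)=\varphi(b_1b_n)\varphi(b_2b_{n-1})\cdots\varphi(b_{(n-1)/2}b_{(n+3)/2})\varphi'(b_{(n+1)/2})$ if $n$ is odd and $k_1=k_n,k_2=k_{n-1},\dots,k_{(n-1)/2}=k_{(n+3)/2}$, and $0$ otherwise. *)

(* Defs.v *)
From HB Require Import structures.
From mathcomp Require Import all_boot all_order all_algebra.
From mathcomp Require Import complex.
From mathcomp Require Import reals.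
Set Implicit Arguments. Unset Strict Implicit. Unset Printing Implicit Defensive.
Import Order.TTheory GRing.Theory Num.Theory.
Local Open Scope ring_scope.

Section TypeBprime.
Variable (R : realType).
Local Notation C := (R[i])%C.
Variable (A : algType C) (F : lmodType C).
(* data of an ncps of type B' : (A, phi, F, Phi); F is a (possibly non-unital)
   algebra with product mulF, an A-bimodule with actions lact, ract *)
Variables (phi : A -> C) (mulF : F -> F -> F)
          (lact : A -> F -> F) (ract : F -> A -> F) (Phi : F -> C).

Definition ncps_typeBprime : Prop :=
  (forall (c : C) x y, phi (c *: x + y) = c * phi x + phi y) /\
  phi 1 = 1 /\
  (forall (c : C) x y, Phi (c *: x + y) = c * Phi x + Phi y) /\
  (forall (c : C) x y z, mulF (c *: x + y) z = c *: mulF x z + mulF y z) /\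
  (forall (c : C) x y z, mulF x (c *: y + z) = c *: mulF x y + mulF x z) /\
  (forall x y z, mulF (mulF x y) z = mulF x (mulF y z)) /\
  (forall (c : C) a b f, lact (c *: a + b) f = c *: lact a f + lact b f) /\
  (forall (c : C) a f g, lact a (c *: f + g) = c *: lact a f + lact a g) /\
  (forall (c : C) a b f, ract f (c *: a + b) = c *: ract f a + ract f b) /\
  (forall (c : C) a f g, ract (c *: f + g) a = c *: ract f a + ract g a) /\
  (forall a b f, lact (a * b) f = lact a (lact b f)) /\
  (forall f, lact 1 f = f) /\
  (forall a b f, ract f (a * b) = ract (ract f a) b) /\
  (forall f, ract f 1 = f) /\
  (forall a b f, lact a (ract f b) = ract (lact a f) b) /\
  (forall a f g, lact a (mulF f g) = mulF (lact a f) g) /\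
  (forall a f g, mulF (ract f a) g = mulF f (lact a g)) /\
  (forall a f g, ract (mulF f g) a = mulF f (ract g a)).

Fixpoint prodF (f : nat -> F) (m : nat) : F :=
  match m with 0 => f 0%N | m'.+1 => mulF (prodF f m') (f m'.+1) end.

Definition subalgA (S : A -> Prop) : Prop :=
  S 1 /\ (forall x y, S x -> S y -> S (x + y)) /\
  (forall (c : C) x, S x -> S (c *: x)) /\ (forall x y, S x -> S y -> S (x * y)).
Definition subalgF (S : F -> Prop) : Prop :=
  S 0 /\ (forall x y, S x -> S y -> S (x + y)) /\
  (forall (c : C) x, S x -> S (c *: x)) /\ (forall x y, S x -> S y -> S (mulF x y)).

Definition genA (S : A -> Prop) : A -> Prop :=
  fun x => forall T, subalgA T -> (forall y, S y -> T y) -> T x.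
Definition genF (S : F -> Prop) : F -> Prop :=
  fun x => forall T, subalgF T -> (forall y, S y -> T y) -> T x.

Definition free_family (I : Type) (Ai : I -> A -> Prop) : Prop :=
  forall (n : nat) (i : nat -> I) (c : nat -> A), (0 < n)%N ->
    (forall l, (l.+1 < n)%N -> i l <> i l.+1) ->
    (forall l, (l < n)%N -> Ai (i l) (c l)) ->
    (forall l, (l < n)%N -> phi (c l) = 0) ->
    phi (\prod_(0 <= l < n) c l) = 0.

(* cyclic-antimonotone independence of (A0, F0); here n = m.+1 >= 1,
   c 0, ..., c n in A0 and g 1, ..., g n in F0 *)
Definition cyc_antimonotone (A0 : A -> Prop) (F0 : F -> Prop) : Prop :=
  forall (m : nat) (c : nat -> A) (g : nat -> F),
    (forall l, (l <= m.+1)%N -> A0 (c l)) ->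
    (forall l, (1 <= l <= m.+1)%N -> F0 (g l)) ->
    Phi (lact (c 0%N) (prodF (fun l => ract (g l.+1) (c l.+1)) m)) =
    phi (c 0%N * c m.+1) * (\prod_(1 <= l < m.+1) phi (c l)) *
      Phi (prodF (fun l => g l.+1) m).

(* trivial independence of (F_j) w.r.t. Phi; n = m.+1 >= 2 *)
Definition trivially_independent (J : Type) (Fj : J -> F -> Prop) : Prop :=
  forall (m : nat) (j : nat -> J) (g : nat -> F), (1 <= m)%N ->
    (forall l, (l < m)%N -> j l <> j l.+1) ->
    (forall l, (l <= m)%N -> Fj (j l) (g l)) ->
    Phi (prodF g m) = 0.

Definition all_A (I : Type) (Ai : I -> A -> Prop) : A -> Prop :=
  genA (fun x => exists i, Ai i x).
Definition all_F (J : Type) (Fj : J -> F -> Prop) : F -> Prop :=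
  genF (fun x => exists j, Fj j x).

Definition weakly_Bprime_free (I J : Type) (Ai : I -> A -> Prop)
    (Fj : J -> F -> Prop) : Prop :=
  free_family Ai /\ cyc_antimonotone (all_A Ai) (all_F Fj).
Definition Bprime_free (I J : Type) (Ai : I -> A -> Prop)
    (Fj : J -> F -> Prop) : Prop :=
  weakly_Bprime_free Ai Fj /\ trivially_independent Fj.

Definition Bt : Type := (A * F)%type.
Definition oneB : Bt := (1, 0).
Definition mulB (x y : Bt) : Bt :=
  (x.1 * y.1, lact x.1 y.2 + ract x.2 y.1 + mulF x.2 y.2).
Definition phiB (x : Bt) : C := phi x.1.
Definition phiB' (x : Bt) : C := Phi x.2.
Definition prodB (b : nat -> Bt) (n : nat) : Bt :=
  foldr mulB oneB [seq b l | l <- iota 0 n].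

Definition inf_free (K : Type) (Bk : K -> Bt -> Prop) : Prop :=
  forall (n : nat) (k : nat -> K) (b : nat -> Bt), (0 < n)%N ->
    (forall l, (l.+1 < n)%N -> k l <> k l.+1) ->
    (forall l, (l < n)%N -> Bk (k l) (b l)) ->
    (forall l, (l < n)%N -> phiB (b l) = 0) ->
    phiB (prodB b n) = 0 /\
    let sym := odd n /\ (forall l, (l < n)%N -> k l = k (n.-1 - l)%N) in
    (sym -> phiB' (prodB b n) =
       (\prod_(0 <= l < n./2) phiB (mulB (b l) (b (n.-1 - l)%N))) *
         phiB' (b n./2)) /\
    (~ sym -> phiB' (prodB b n) = 0).

Definition embA (S : A -> Prop) : Bt -> Prop :=
  fun x => S x.1 /\ x.2 = 0.
Definition embF (S : F -> Prop) : Bt -> Prop :=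
  fun x => (exists c : C, x.1 = c%:A) /\ S x.2.

Definition family_A'F' (I J : Type) (Ai : I -> A -> Prop) (Fj : J -> F -> Prop)
  : I + J -> Bt -> Prop :=
  fun k => match k with inl i => embA (Ai i) | inr j => embF (Fj j) end.
Definition family_A'F'all (I J : Type) (Ai : I -> A -> Prop) (Fj : J -> F -> Prop)
  : option I -> Bt -> Prop :=
  fun k => match k with Some i => embA (Ai i) | None => embF (all_F Fj) end.

End TypeBprime.

(* Main.v *)
(** Work with words: products in [B] of centered elements of the [A_i'] and
    [F_j'] with consecutive indices distinct.  A centered element of [F_j'] is
    some [(0, g)] with [g] in [F_j], so infinitesimal freeness amounts to three
    conditions: freeness of the [A_i]; [phi'] vanishes on every word with at
    least two letters from [F]; and [phi' (u g v) = phi (u v) * Phi g] when [u]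
    and [v] are words in [A].  The last one is the palindromic formula, since
    freeness evaluates [phi (u v)] by collapsing [u] against [v] from the middle.

    Given B'-freeness, collect the run of [F]-letters following the first one:
    the next nonempty [A]-run before another [F]-letter has [phi] equal to zero,
    which kills the word by cyclic antimonotone independence; if there is no such
    run, trivial independence kills it.  Conversely, words span the algebra
    generated by the [A_i'] and [F_j'], so the three conditions show that a gap
    [g c g'] contributes [phi c] and can be closed up, which reduces cyclic
    antimonotone independence to the case of one factor [g].

    Part (B) is part (A) for the one-element family [<F_j : j>]. *)
Require Import Defs.
From HB Require Import structures.
From mathcomp Require Import all_boot all_order all_algebra.
From mathcomp Require Import ssrAC zify complex boolp.
From mathcomp Require Import reals.
Set Implicit Arguments. Unset Strict Implicit. Unset Printing Implicit Defensive.
Import GRing.Theory.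
Local Open Scope ring_scope.

(** The closure rule has the shape [c *: x + y] in which linearity of [phi], [Phi] and the products
    is stated, so one induction case covers sums and multiples. *)
Inductive lspan (K : pzRingType) (V : lmodType K) (P : V -> Prop) : V -> Prop :=
| lspan_in x : P x -> lspan P x
| lspan_0 : lspan P 0
| lspan_lin (c : K) x y : lspan P x -> lspan P y -> lspan P (c *: x + y).

Lemma lspan_scale (K : pzRingType) (V : lmodType K) (P : V -> Prop) (c : K) x :
  lspan P x -> lspan P (c *: x).
Proof. by move=> Px; rewrite -[_ *: _]addr0; apply: lspan_lin => //; apply: lspan_0. Qed.

Lemma lspan_add (K : pzRingType) (V : lmodType K) (P : V -> Prop) x y :
  lspan P x -> lspan P y -> lspan P (x + y).
Proof. by move=> Px Py; rewrite -[x]scale1r; apply: lspan_lin. Qed.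

Lemma lspan_sub (K : pzRingType) (V : lmodType K) (P Q : V -> Prop) x :
  (forall y, P y -> lspan Q y) -> lspan P x -> lspan Q x.
Proof.
move=> PQ; elim=> [y /PQ //| |c y z _ Qy _ Qz]; first exact: lspan_0.
exact: lspan_lin.
Qed.

Lemma additive_at0 (U V : zmodType) (f : U -> V) :
  (forall x y, f (x + y) = f x + f y) -> f 0 = 0.
Proof. by move=> fD; apply: (addrI (f 0)); rewrite -fD !addr0. Qed.

(** * The algebra [B] *)

Section Words.
Variable R : realType.
Local Notation C := (R[i])%C.
Variables (A : algType C) (F : lmodType C).
Variables (phi : A -> C) (mulF : F -> F -> F).
Variables (lact : A -> F -> F) (ract : F -> A -> F) (Phi : F -> C).
Hypothesis ncps : ncps_typeBprime phi mulF lact ract Phi.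

Local Notation B := (Bt A F).
Local Notation "x ** y" := (mulB mulF lact ract x y)
  (at level 40, left associativity).
Local Notation one := (oneB A F).
Local Notation phiB := (@phiB _ A F phi).
Local Notation phiB' := (@phiB' _ A F Phi).

Lemma phi_lin c x y : phi (c *: x + y) = c * phi x + phi y.
Proof. by case: ncps. Qed.
Lemma phi1 : phi 1 = 1.
Proof. by case: ncps => _ []. Qed.
Lemma Phi_lin c x y : Phi (c *: x + y) = c * Phi x + Phi y.
Proof. by case: ncps => _ [_ []]. Qed.

Lemma mulF_linl c x y z : mulF (c *: x + y) z = c *: mulF x z + mulF y z.
Proof. by move: ncps; rewrite /ncps_typeBprime; intuition. Qed.
Lemma mulF_linr c x y z : mulF x (c *: y + z) = c *: mulF x y + mulF x z.
Proof. by move: ncps; rewrite /ncps_typeBprime; intuition. Qed.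
Lemma mulFA x y z : mulF (mulF x y) z = mulF x (mulF y z).
Proof. by move: ncps; rewrite /ncps_typeBprime; intuition. Qed.
Lemma lact_linl c a b f : lact (c *: a + b) f = c *: lact a f + lact b f.
Proof. by move: ncps; rewrite /ncps_typeBprime; intuition. Qed.
Lemma lact_linr c a f g : lact a (c *: f + g) = c *: lact a f + lact a g.
Proof. by move: ncps; rewrite /ncps_typeBprime; intuition. Qed.
Lemma ract_linr c a b f : ract f (c *: a + b) = c *: ract f a + ract f b.
Proof. by move: ncps; rewrite /ncps_typeBprime; intuition. Qed.
Lemma ract_linl c a f g : ract (c *: f + g) a = c *: ract f a + ract g a.
Proof. by move: ncps; rewrite /ncps_typeBprime; intuition. Qed.
Lemma lactM a b f : lact (a * b) f = lact a (lact b f).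
Proof. by move: ncps; rewrite /ncps_typeBprime; intuition. Qed.
Lemma lact1 f : lact 1 f = f.
Proof. by move: ncps; rewrite /ncps_typeBprime; intuition. Qed.
Lemma ractM a b f : ract f (a * b) = ract (ract f a) b.
Proof. by move: ncps; rewrite /ncps_typeBprime; intuition. Qed.
Lemma ract1 f : ract f 1 = f.
Proof. by move: ncps; rewrite /ncps_typeBprime; intuition. Qed.
Lemma lactract a b f : lact a (ract f b) = ract (lact a f) b.
Proof. by move: ncps; rewrite /ncps_typeBprime; intuition. Qed.
Lemma lactmulF a f g : lact a (mulF f g) = mulF (lact a f) g.
Proof. by move: ncps; rewrite /ncps_typeBprime; intuition. Qed.
Lemma mulFract a f g : mulF (ract f a) g = mulF f (lact a g).
Proof. by move: ncps; rewrite /ncps_typeBprime; intuition. Qed.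
Lemma ractmulF a f g : ract (mulF f g) a = mulF f (ract g a).
Proof. by move: ncps; rewrite /ncps_typeBprime; intuition. Qed.

Lemma mulFDl x y z : mulF (x + y) z = mulF x z + mulF y z.
Proof. by rewrite -[x]scale1r mulF_linl !scale1r. Qed.
Lemma mulFDr x y z : mulF x (y + z) = mulF x y + mulF x z.
Proof. by rewrite -[y]scale1r mulF_linr !scale1r. Qed.
Lemma lactDl a b f : lact (a + b) f = lact a f + lact b f.
Proof. by rewrite -[a]scale1r lact_linl !scale1r. Qed.
Lemma lactDr a f g : lact a (f + g) = lact a f + lact a g.
Proof. by rewrite -[f]scale1r lact_linr !scale1r. Qed.
Lemma ractDl a f g : ract (f + g) a = ract f a + ract g a.
Proof. by rewrite -[f]scale1r ract_linl !scale1r. Qed.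
Lemma ractDr a b f : ract f (a + b) = ract f a + ract f b.
Proof. by rewrite -[a]scale1r ract_linr !scale1r. Qed.
Lemma mul0F f : mulF 0 f = 0.
Proof. by apply: (additive_at0 (f := mulF^~ f)) => x y; apply: mulFDl. Qed.
Lemma mulF0 f : mulF f 0 = 0.
Proof. by apply: additive_at0 => x y; apply: mulFDr. Qed.
Lemma lact0 a : lact a 0 = 0.
Proof. by apply: additive_at0 => x y; apply: lactDr. Qed.
Lemma lact0l f : lact 0 f = 0.
Proof. by apply: (additive_at0 (f := lact^~ f)) => x y; apply: lactDl. Qed.
Lemma ract0 f : ract f 0 = 0.
Proof. by apply: additive_at0 => x y; apply: ractDr. Qed.
Lemma ract0l a : ract 0 a = 0.
Proof. by apply: (additive_at0 (f := ract^~ a)) => x y; apply: ractDl. Qed.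
Lemma phi0 : phi 0 = 0.
Proof. by apply: additive_at0 => x y; rewrite -[x]scale1r phi_lin !scale1r mul1r. Qed.
Lemma Phi0 : Phi 0 = 0.
Proof. by apply: additive_at0 => x y; rewrite -[x]scale1r Phi_lin !scale1r mul1r. Qed.
Lemma phiA c : phi c%:A = c.
Proof. by rewrite -[c%:A]addr0 phi_lin phi1 phi0 mulr1 addr0. Qed.
Lemma lactA c f : lact c%:A f = c *: f.
Proof. by rewrite -[c%:A]addr0 lact_linl lact1 lact0l addr0. Qed.
Lemma ractA c f : ract f c%:A = c *: f.
Proof. by rewrite -[c%:A]addr0 ract_linr ract1 ract0 addr0. Qed.

Lemma mulB_linl c x y z : (c *: x + y) ** z = c *: (x ** z) + y ** z.
Proof.
rewrite /mulB; congr pair => /=; first by rewrite mulrDl scalerAl.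
rewrite lact_linl ract_linl mulF_linl !scalerDr.
by rewrite !addrA [LHS](ACl (1*3*5*2*4*6)).
Qed.

Lemma mulB_linr c x y z : x ** (c *: y + z) = c *: (x ** y) + x ** z.
Proof.
rewrite /mulB; congr pair => /=; first by rewrite mulrDr scalerAr.
rewrite lact_linr ract_linr mulF_linr !scalerDr.
by rewrite !addrA [LHS](ACl (1*3*5*2*4*6)).
Qed.

Lemma mulBA x y z : x ** (y ** z) = x ** y ** z.
Proof.
rewrite /mulB; congr pair => /=; first by rewrite mulrA.
rewrite !(mulFDl, mulFDr, lactDr, ractDl) !(lactM, ractM) lactract lactmulF.
by rewrite mulFract ractmulF mulFA !addrA [LHS](ACl (1*2*4*6*3*5*7)).
Qed.

Lemma mul1B x : one ** x = x.
Proof. by case: x => a f; rewrite /mulB /= mul1r lact1 ract0l mul0F !addr0. Qed.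
Lemma mulB1 x : x ** one = x.
Proof. by case: x => a f; rewrite /mulB /= mulr1 ract1 lact0 mulF0 add0r addr0. Qed.

Lemma mulBDl x y z : (x + y) ** z = x ** z + y ** z.
Proof. by rewrite -[x]scale1r mulB_linl !scale1r. Qed.
Lemma mulBDr x y z : x ** (y + z) = x ** y + x ** z.
Proof. by rewrite -[y]scale1r mulB_linr !scale1r. Qed.
Lemma mul0B x : 0 ** x = 0.
Proof. by apply: (additive_at0 (f := fun y => y ** x)) => y z; rewrite mulBDl. Qed.
Lemma mulB0 x : x ** 0 = 0.
Proof. by apply: additive_at0 => y z; rewrite mulBDr. Qed.
Lemma scaleBl c x y : (c *: x) ** y = c *: (x ** y).
Proof. by rewrite -[c *: x]addr0 mulB_linl mul0B addr0. Qed.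

Lemma phiB_lin c x y : phiB (c *: x + y) = c * phiB x + phiB y.
Proof. exact: phi_lin. Qed.
Lemma phiB'_lin c x y : phiB' (c *: x + y) = c * phiB' x + phiB' y.
Proof. exact: Phi_lin. Qed.
Lemma phiB0 : phiB 0 = 0. Proof. exact: phi0. Qed.
Lemma phiB'0 : phiB' 0 = 0. Proof. exact: Phi0. Qed.
Lemma phiB1 : phiB one = 1. Proof. exact: phi1. Qed.

Variables (I J : eqType) (Ai : I -> A -> Prop) (Fj : J -> F -> Prop).
Hypothesis subA : forall i, subalgA (Ai i).
Hypothesis subF : forall j, subalgF mulF (Fj j).

Local Notation K := (I + J)%type.
Local Notation fam := (family_A'F' Ai Fj).

Lemma family_one k : fam k one.
Proof.
case: k => [i|j]; first by split=> //; case: (subA i).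
split; last by case: (subF j).
by exists 1; rewrite scale1r.
Qed.

Lemma family_lin k c x y : fam k x -> fam k y -> fam k (c *: x + y).
Proof.
case: k => [i|j] /= [x1 x2] [y1 y2].
  split; last by rewrite /= x2 y2 scaler0 addr0.
  by case: (subA i) => _ [SD [SZ _]]; apply: SD => //; apply: SZ.
case: (subF j) => _ [SD [SZ _]]; split; last by apply: SD => //; apply: SZ.
case: x1 => d xE; case: y1 => e yE; exists (c * d + e).
by rewrite /= xE yE scalerDl scalerA.
Qed.

Lemma family_mul k x y : fam k x -> fam k y -> fam k (x ** y).
Proof.
case: k => [i|j] /= [x1 x2] [y1 y2].
  split; first by case: (subA i) => _ [_ [_ SM]]; apply: SM.
  by rewrite /= x2 y2 lact0 ract0l mul0F !addr0.
case: (subF j) => _ [SD [SZ SM]].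
case: x1 => d xE; case: y1 => e yE; split.
  by exists (d * e); rewrite /= xE yE -scalerAl mul1r scalerA.
rewrite /= xE yE lactA ractA; apply: (SD); last exact: SM.
by apply: SD; apply: SZ.
Qed.

(** * Alternating centered words *)

Definition centered (x : K * B) : Prop := fam x.1 x.2 /\ phiB x.2 = 0.

(** Each member of the family contains the unit, so subtracting [phiB x *: one] stays inside it.
    This centering is what turns a product of two letters with the same index back into letters. *)
Lemma family_split k x : fam k x ->
  exists2 x0, centered (k, x0) & x = phiB x *: one + x0.
Proof.
move=> fx; exists (- phiB x *: one + x); last first.
  by rewrite addrA -scalerDl subrr scale0r add0r.
split; first by apply: family_lin => //; apply: family_one.
by rewrite /= phiB_lin phiB1 mulr1 addNr.
Qed.

Definition isF (x : K * B) : bool := if x.1 is inr _ then true else false.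
Definition isA (x : K * B) : bool := ~~ isF x.

Lemma centeredA x : centered x -> isA x ->
  exists i a, [/\ x = (inl i, (a, 0)), Ai i a & phi a = 0].
Proof.
case: x => [[i|j] [a f]] //= [[/= fa f0] pa] _; exists i, a; split=> //.
by move: f0 => /= ->.
Qed.

Lemma centeredF x : centered x -> isF x ->
  exists j g, x = (inr j, (0, g)) /\ Fj j g.
Proof.
case: x => [[i|j] [a g]] //= [[/= [c cE] fg] pa] _; exists j, g; split=> //.
by move: pa; rewrite /Defs.phiB /= cE phiA => ->; rewrite scale0r.
Qed.

Lemma centered_inA i a : Ai i a -> phi a = 0 -> centered (inl i, (a, 0)).
Proof. by []. Qed.
Lemma centered_inF j g : Fj j g -> centered (inr j, (0, g)).
Proof.
by move=> fg; split; [split=> //; exists 0; rewrite scale0r | exact: phi0].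
Qed.

Definition wprod (w : seq (K * B)) : B := foldr (mulB mulF lact ract) one (unzip2 w).

Lemma wprod_cons x w : wprod (x :: w) = x.2 ** wprod w.
Proof. by []. Qed.
Lemma wprod_cat u v : wprod (u ++ v) = wprod u ** wprod v.
Proof. by elim: u => [|x u IH] /=; rewrite ?mul1B // !wprod_cons IH mulBA. Qed.

Local Notation alt := (sorted (fun x y : K * B => x.1 != y.1)).
Definition good (w : seq (K * B)) : Prop := alt w /\ forall x, x \in w -> centered x.

Definition new_key (k : K) (w : seq (K * B)) : bool :=
  if w is y :: _ then k != y.1 else true.

Lemma good_cons x w : good (x :: w) <->
  [/\ centered x, good w & new_key x.1 w].
Proof.
split=> [[sw cw]|[cx [sw cw] xw]].
  split; first by apply: cw; rewrite mem_head.
    split; first exact: path_sorted sw.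
    by move=> y yw; apply: cw; rewrite inE yw orbT.
  by case: w sw {cw} => //= y w /andP[].
split; last by move=> y; rewrite inE => /orP[/eqP->|/cw].
by case: w xw sw {cw} => //= y w -> ->.
Qed.

Lemma good_cat u v : good u -> good v ->
  (forall x, x \in u -> new_key x.1 v) -> good (u ++ v).
Proof.
elim: u => [|x u IH] //= /good_cons[cx gu xu] gv uv.
apply/good_cons; split=> //.
  by apply: IH => // y yu; apply: uv; rewrite inE yu orbT.
by case: u xu {IH gu} uv => //= _ uv; have := uv x (mem_head x [::]); case: v {gv uv}.
Qed.

Lemma good_catl u v : good (u ++ v) -> good u.
Proof.
elim: u => [|x u IH] //= /good_cons[cx /IH gu xu]; apply/good_cons; split=> //.
by case: u xu {IH gu}.
Qed.

Lemma good_catr u v : good (u ++ v) -> good v.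
Proof. by elim: u => [|x u IH] //= /good_cons[cx /IH]. Qed.

Lemma good_rev u : good u -> good (rev u).
Proof.
case=> su cu; split; last by move=> x; rewrite mem_rev => /cu.
rewrite rev_sorted; congr (is_true _): su; case: u {cu} => //= x u.
by apply: eq_path => y z /=; rewrite eq_sym.
Qed.

(** Both words are read outward from the junction at [x]; the induction moves the letters of [u] one
    at a time to the front of the second word. *)
Lemma good_revcat u x v : good (x :: u) -> good (x :: v) -> good (rev u ++ x :: v).
Proof.
elim: u x v => [|y u IH] x v // /good_cons[cx gu xy] gv.
rewrite rev_cons cat_rcons; apply: IH => //; apply/good_cons; split=> //.
  by case/good_cons: gu.
by rewrite /new_key eq_sym.
Qed.

Lemma inl_inr_key (x y : K * B) : isF x != isF y -> x.1 != y.1.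
Proof. by case: x y => [[i|j] a] [[i'|j'] b]. Qed.

Definition word_free : Prop := forall w, good w -> w != [::] -> phiB (wprod w) = 0.

(* The middle letters of [rev u ++ v] either have different indices, and freeness
   applies, or their product splits into a scalar and a centered letter. *)
Lemma pairing u v : word_free -> good u -> good v ->
  phiB (wprod (rev u) ** wprod v) =
  if unzip1 u == unzip1 v then \prod_(z <- zip u v) phiB (z.1.2 ** z.2.2) else 0.
Proof.
move=> fr; elim: u v => [|x u IH] [|y v] gu gv.
- by rewrite big_nil mulB1 phiB1.
- by rewrite mul1B fr.
- by rewrite mulB1 fr //; [exact: good_rev | rewrite -size_eq0 size_rev].
rewrite -wprod_cat rev_cons cat_rcons /= eqseq_cons.
case: eqVneq => [xy|nxy] /=; last first.
  apply: fr; last by case: (rev u).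
  apply: good_revcat => //; apply/good_cons; split=> //.
  by case/good_cons: gu.
case: x y xy gu gv => [k x] [_ y] /= <- /good_cons[/= cx gu xu] /good_cons[/= cy gv yv].
have [z cz zE] := family_split (family_mul cx.1 cy.1).
rewrite wprod_cat !wprod_cons /= [x ** (_ ** _)]mulBA {1}zE mulB_linl mulB_linr.
rewrite mul1B phiB_lin.
rewrite IH // -[z ** _]/(wprod ((k, z) :: v)) -wprod_cat fr.
- by rewrite big_cons /= addr0; case: eqP => // _; rewrite mulr0.
- apply: good_revcat; apply/good_cons; split=> //.
by case: (rev u).
Qed.

Definition words (p : pred (K * B)) (b : B) : Prop :=
  exists2 w, good w /\ all p w & b = wprod w.

(** After centering [x], the scalar part leaves the word alone. The centered part becomes a new
    first letter, or, if the first index is already [k], is multiplied into that letter and the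
    product is centered again. Since this creates new letters, [p] has to accept everything of index
    [k]. *)
Lemma words_lmul (p : pred (K * B)) k x y : (forall b, p (k, b)) -> fam k x ->
  lspan (words p) y -> lspan (words p) (x ** y).
Proof.
move=> pk fx; elim=> [{}y [w [gw pw] ->]| |c y1 y2 _ IH1 _ IH2]; last first.
- by rewrite mulB_linr; apply: lspan_lin.
- by rewrite mulB0; apply: lspan_0.
have [x0 cx0 ->] := family_split fx.
rewrite mulB_linl mul1B; apply: lspan_lin; first by apply: lspan_in; exists w.
have cons z v : centered (k, z) -> good v -> all p v ->
    new_key k v -> lspan (words p) (z ** wprod v).
  move=> cz gv pv kv; apply: lspan_in; exists ((k, z) :: v) => //.
  by split; [apply/good_cons; split | rewrite /= pk].
case: w gw pw => [|[k' z] w] gw pw; first exact: cons.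
case: (eqVneq k k') => [kk'|kk']; last exact: cons.
rewrite -{}kk' in gw pw; case/good_cons: gw => cz gw zw.
case/andP: pw => _ pw.
have [t ct tE] := family_split (family_mul cx0.1 cz.1).
rewrite wprod_cons mulBA tE mulB_linl mul1B; apply: lspan_lin; last exact: cons.
by apply: lspan_in; exists w.
Qed.

Lemma all_isA w : all isA w = ~~ has isF w.
Proof. by rewrite -all_predC. Qed.

Lemma wprodF1 w : good w -> has isF w -> (wprod w).1 = 0.
Proof.
elim: w => [|x w IH] //= /good_cons[cx gw _] /orP[Fx|/IH->//]; last by rewrite mulr0.
by have [j [g [-> _]]] := centeredF cx Fx; rewrite mul0r.
Qed.

Lemma wprodA w : good w -> all isA w -> wprod w = (\prod_(x <- w) x.2.1, 0).
Proof.
elim: w => [|x w IH] //=; first by rewrite big_nil.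
move=> /good_cons[cx gw _] /andP[Ax /IH IHw]; rewrite wprod_cons IHw // big_cons.
by have [i [a [-> _ _]]] := centeredA cx Ax; rewrite /mulB /= lact0 ract0l mul0F !addr0.
Qed.

Lemma good_mkseq n (k : nat -> K) (b : nat -> B) :
  (forall l, (l.+1 < n)%N -> k l <> k l.+1) ->
  (forall l, (l < n)%N -> centered (k l, b l)) ->
  good (mkseq (fun l => (k l, b l)) n).
Proof.
move=> kn cn; split.
  apply/(sortedP (k 0, b 0)) => l; rewrite size_mkseq => ln.
  by rewrite !nth_mkseq //= ?(ltnW ln) //; apply/eqP/kn.
by move=> x /mapP[l]; rewrite mem_iota => /andP[_ ln] ->; apply: cn.
Qed.

Lemma good_nth x0 w : good w ->
  (forall l, (l.+1 < size w)%N -> (nth x0 w l).1 <> (nth x0 w l.+1).1) /\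
  (forall l, (l < size w)%N -> centered (nth x0 w l)).
Proof.
case=> /(sortedP x0) sw cw; split=> l ln; first by apply/eqP/sw.
by apply: cw; rewrite mem_nth.
Qed.

Lemma prodB_mkseq n (k : nat -> K) (b : nat -> B) :
  prodB mulF lact ract b n = wprod (mkseq (fun l => (k l, b l)) n).
Proof. by rewrite /prodB /wprod /unzip2 -map_comp. Qed.

Lemma prodB_nth x0 w :
  prodB mulF lact ract (fun l => (nth x0 w l).2) (size w) = wprod w.
Proof.
rewrite (prodB_mkseq _ (fun l => (nth x0 w l).1)); congr wprod.
by rewrite -[RHS](mkseq_nth x0); apply: eq_mkseq => l; case: nth.
Qed.

(** A word with an [F]-letter has zero component in [A], so [phiB] kills it; on the remaining words
    [wprod] is an alternating product in [A]. *)
Lemma free_familyP : free_family phi Ai <-> word_free.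
Proof.
split=> [fr w gw w0|fr n i c n0 ic cA c0].
  case: (boolP (has isF w)) => [Fw|]; first by rewrite /Defs.phiB wprodF1 ?phi0.
  rewrite -all_isA => Aw; rewrite wprodA // /Defs.phiB /=.
  case: w => [//|x0 w] in w0 gw Aw *; set s := x0 :: w in gw Aw *.
  have [i0 _] : exists i a, [/\ x0 = (inl i, (a, 0)), Ai i a & phi a = 0].
    apply: centeredA; first by case: gw => _ cw; apply: cw; rewrite mem_head.
    by apply: (allP Aw); rewrite mem_head.
  have [kn cn] := good_nth x0 gw.
  (* The default [i0] comes from the first letter and only makes [key] total: every letter of [s]
     has an index in [I]. *)
  pose key (k : K) := if k is inl i then i else i0.
  have nthE l : (l < size s)%N -> exists i a,
      [/\ nth x0 s l = (inl i, (a, 0)), Ai i a & phi a = 0].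
    move=> ln; apply: centeredA; first exact: cn.
    by apply: (allP Aw); apply: mem_nth.
  rewrite (big_nth x0); apply: (fr _ (fun l => key (nth x0 s l).1)) => // l ln.
  - have [i [a [E _ _]]] := nthE _ (ltnW ln); have [i' [a' [E' _ _]]] := nthE _ ln.
    by have := kn _ ln; rewrite E E' /= => ne e; apply: ne; rewrite e.
  - by have [i [a [-> ? _]]] := nthE _ ln.
  - by have [i [a [-> _ ?]]] := nthE _ ln.
pose w := mkseq (fun l => (inl (i l) : K, (c l, 0) : B)) n.
have gw : good w.
  apply: good_mkseq => l ln; first by move=> [] /ic; apply.
  by apply: centered_inA; [exact: cA | exact: c0].
have Aw : all isA w by apply/allP=> x /mapP[l _ ->].
have := fr w gw; rewrite wprodA // -size_eq0 size_mkseq -lt0n => /(_ n0).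
by rewrite /Defs.phiB /= big_map /index_iota subn0.
Qed.

(** * Infinitesimal freeness in terms of words *)

Definition palindrome (w : seq (K * B)) : bool :=
  odd (size w) && (rev (unzip1 w) == unzip1 w).

Definition fold_value (w : seq (K * B)) : C :=
  let b := nth 0 (unzip2 w) in
  (\prod_(0 <= l < (size w)./2) phiB (b l ** b ((size w).-1 - l)%N)) *
    phiB' (b (size w)./2).

(** Sequences on [nat] are traded for lists through [mkseq] and [nth]. The condition
    [k l = k (n.-1 - l)] says that the list of indices equals its reverse, which [palindrome]
    tests. *)
Lemma inf_free_words : inf_free phi mulF lact ract Phi fam <->
  forall w, good w -> w != [::] ->
    phiB (wprod w) = 0 /\ phiB' (wprod w) = if palindrome w then fold_value w else 0.
Proof.
split=> [ifr w gw w0|H n k b n0 kn bn pn].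
  case: w => [//|x0 w] in w0 gw *; set s := x0 :: w in gw *.
  have [kn cn] := good_nth x0 gw.
  have [||l /cn[]//|l /cn[]//|] :=
    ifr (size s) (fun l => (nth x0 s l).1) (fun l => (nth x0 s l).2) => //.
  cbv zeta; rewrite prodB_nth => -> [sym nsym]; split=> //.
  have bE l : (l < size s)%N -> nth 0 (unzip2 s) l = (nth x0 s l).2.
    by move=> ln; rewrite (nth_map x0).
  case: ifP => [/andP[os /eqP ks]|ps]; last first.
    apply: nsym => -[os ks]; case/negP: (negbT ps); apply/andP; split=> //.
    apply/eqP/(@eq_from_nth _ x0.1); rewrite size_rev // => l; rewrite size_map => ln.
    rewrite nth_rev size_map // !(nth_map x0) //; last by rewrite ltn_subrL.
    by rewrite [RHS]ks // subnS predn_sub.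
  rewrite sym /fold_value.
    congr (_ * _); last by rewrite bE //=; lia.
    rewrite [LHS]big_nat [RHS]big_nat; apply: eq_bigr => l /andP[_ ln].
    by rewrite !bE //; rewrite /= in ln *; lia.
  split=> // l ln; rewrite -!(nth_map x0 x0.1 fst) //; last by rewrite /=; lia.
  rewrite -/(unzip1 s) -[in LHS]ks nth_rev size_map //; congr nth => /=; lia.
pose w := mkseq (fun l => (k l, b l)) n.
have gw : good w by apply: good_mkseq => // l ln; split; [exact: bn|exact: pn].
have sw : size w = n by rewrite size_mkseq.
have [|p0 p'] := H w gw; first by rewrite -size_eq0 sw -lt0n.
rewrite (prodB_mkseq _ k) p'; split=> //=.
have bE l : (l < n)%N -> nth 0 (unzip2 w) l = b l.
  by move=> ln; rewrite /unzip2 -map_comp (nth_map 0%N) ?size_iota // nth_iota.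
have kE : unzip1 w = mkseq k n by rewrite /unzip1 -map_comp.
split=> [[on ks]|nsym].
  have -> : palindrome w.
    rewrite /palindrome sw on /= kE; apply/eqP/(@eq_from_nth _ (k 0)).
      by rewrite size_rev.
    move=> l; rewrite size_rev size_mkseq => ln.
    rewrite nth_rev size_mkseq // !nth_mkseq //; last by rewrite ltn_subrL.
    by rewrite [RHS]ks // subnS predn_sub.
  rewrite /fold_value sw; congr (_ * _); last by rewrite bE //; lia.
  rewrite [LHS]big_nat [RHS]big_nat; apply: eq_bigr => l /andP[_ ln].
  by rewrite !bE //; lia.
case: ifP => // /andP[]; rewrite sw kE => on /eqP ks; case: nsym; split=> // l ln.
have ln' : (n.-1 - l < n)%N by lia.
rewrite -(nth_mkseq (k 0) k ln) -(nth_mkseq (k 0) k ln') -[in LHS]ks nth_rev size_mkseq //.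
by rewrite subnS predn_sub.
Qed.

Lemma phiB'_isA x : centered x -> isA x -> phiB' x.2 = 0.
Proof. by move=> cx Ax; have [i [a [-> _ _]]] := centeredA cx Ax; apply: Phi0. Qed.

Lemma phiB_mulF x y : centered x -> centered y -> isF x || isF y ->
  phiB (x.2 ** y.2) = 0.
Proof.
move=> cx cy /orP[Fx|Fy].
  by have [j [g [-> _]]] := centeredF cx Fx; rewrite /Defs.phiB /= mul0r phi0.
by have [j [g [-> _]]] := centeredF cy Fy; rewrite /Defs.phiB /= mulr0 phi0.
Qed.

(** The left half is given as [rev u], so that [u] and [v] are both read outward from the middle
    letter, as in [pairing]. *)
Lemma odd_split (w : seq (K * B)) : odd (size w) ->
  exists u x v, w = rev u ++ x :: v /\ size u = size v.
Proof.
move=> ow; case: w => [//|x0 w] in ow *; set s := x0 :: w in ow *.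
have h : ((size s)./2 < size s)%N by lia.
exists (rev (take (size s)./2 s)), (nth x0 s (size s)./2), (drop (size s)./2.+1 s).
split; first by rewrite revK -drop_nth // cat_take_drop.
by rewrite size_rev size_takel 1?ltnW // size_drop; lia.
Qed.

Lemma fold_valueE u x v : size u = size v -> fold_value (rev u ++ x :: v) =
  (\prod_(z <- zip u v) phiB (z.1.2 ** z.2.2)) * phiB' x.2.
Proof.
move=> uv; have sE : size (rev u ++ x :: v) = (size u).*2.+1.
  by rewrite size_cat size_rev /= -uv; lia.
rewrite /fold_value sE /= uphalf_double /unzip2 map_cat map_rev /= nth_cat size_rev.
rewrite size_map ltnn subnn /=; congr (_ * _).
(* [fold_value] pairs the letters from the ends inward, [zip u v] from the middle outward; hence the
   reversal of the index. *)
rewrite (big_nth (x, x)) size_zip -uv minnn big_nat_rev /= big_nat [RHS]big_nat.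
apply: eq_bigr => l /andP[_ lu].
rewrite add0n !nth_cat size_rev size_map nth_zip //= nth_rev size_map; last by lia.
rewrite ifT; last by lia.
rewrite ifF; last by lia.
have -> : (size u - (size u - l.+1).+1 = l)%N by lia.
have -> : ((size u).*2 - (size u - l.+1) - size u = l.+1)%N by lia.
by rewrite /= !(nth_map x) -?uv.
Qed.

Lemma zip_prod0 u v : good u -> good v -> size u = size v -> has isF (u ++ v) ->
  \prod_(z <- zip u v) phiB (z.1.2 ** z.2.2) = 0.
Proof.
elim: u v => [|x u IH] [|y v] //= /good_cons[cx gu _] /good_cons[cy gv _] [uv].
rewrite has_cat /= big_cons /= !orbA => h.
case: (boolP (isF x || isF y)) => [Fxy|nF]; first by rewrite phiB_mulF // mul0r.
rewrite IH ?mulr0 // has_cat; move: h nF.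
by case: (isF x); case: (isF y); rewrite ?orbF.
Qed.

(* The value that infinitesimal freeness prescribes for [phi'] on [w]. *)
Definition target w : C := if palindrome w then fold_value w else 0.

Lemma palindrome_split w : good w -> palindrome w -> exists u x v,
  [/\ w = rev u ++ x :: v, good u, good v, centered x & size u = size v].
Proof.
move=> gw /andP[ow _]; have [u [x [v [wE uv]]]] := odd_split ow.
exists u, x, v; rewrite {}wE {ow} in gw *; split=> //.
- by rewrite -[u]revK; apply: good_rev; apply: good_catl gw.
- by have /good_cons[] := good_catr gw.
- by have /good_cons[] := good_catr gw.
Qed.

(** If the middle letter is from [A], its [phiB'] is zero. Otherwise another [F]-letter lies off the
    middle, and the pair containing it has zero component in [A]. *)
Lemma target_twoF w : good w -> (1 < count isF w)%N -> target w = 0.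
Proof.
rewrite /target => gw; case: ifP => // /(palindrome_split gw)[u [x [v [-> gu gv cx uv]]]].
rewrite fold_valueE // count_cat count_rev /= => c.
case: (boolP (isF x)) => Fx; last by rewrite (phiB'_isA cx Fx) mulr0.
rewrite zip_prod0 ?mul0r // has_count count_cat; rewrite Fx in c; lia.
Qed.

Lemma target_allA w : good w -> all isA w -> target w = 0.
Proof.
rewrite /target => gw; case: ifP => // /(palindrome_split gw)[u [x [v [-> gu gv cx uv]]]].
rewrite all_cat /= => /and3P[_ Ax _].
by rewrite fold_valueE // (phiB'_isA cx Ax) mulr0.
Qed.

(** Only [x] has an index in [J], so a palindrome must have [x] in the middle and matching indices
    in [u] and [v]. This is the condition under which [pairing] gives the product of the pairs, and
    it gives zero otherwise. *)
Lemma target_oneF u x v : word_free -> good u -> good v -> all isA u -> all isA v ->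
  isF x -> target (rev u ++ x :: v) = phiB (wprod (rev u) ** wprod v) * phiB' x.2.
Proof.
move=> fr gu gv Au Av Fx; rewrite pairing //.
have notin w : all isA w -> x.1 \notin unzip1 w.
  move=> Aw; apply/mapP => -[y yw xy]; have := allP Aw y yw.
  by move: Fx; rewrite /isA /isF xy => ->.
have -> : target (rev u ++ x :: v) =
    if unzip1 u == unzip1 v then fold_value (rev u ++ x :: v) else 0.
  rewrite /target; congr (if _ then _ else _).
  rewrite /palindrome /unzip1 map_cat map_rev /= -/(unzip1 u) -/(unzip1 v).
  rewrite rev_cat revK rev_cons cat_rcons.
  apply/andP/eqP => [[_ /eqP e]|uv]; last first.
    have := congr1 size uv; rewrite !size_map => suv.
    by split; [rewrite size_cat size_rev /= suv; lia | rewrite uv].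
  (* The index of [x] occurs once, so comparing its position in the list and in the reversed list
     gives equal lengths of [u] and [v]. *)
  have /eqP := congr1 (index x.1) e.
  rewrite !index_cat !mem_rev !(negPf (notin _ _)) //= eqxx !addn0 !size_rev => /eqP s.
  by move/eqP: e; rewrite eqseq_cat ?size_rev // eqseq_cons eqxx /= => /andP[_ /eqP].
case: eqP => [uv|]; last by rewrite mul0r.
by rewrite fold_valueE //; have := congr1 size uv; rewrite !size_map.
Qed.

Definition two_F_vanish : Prop := forall w, good w -> (1 < count isF w)%N ->
  phiB' (wprod w) = 0.
Definition one_F_factor : Prop := forall u x v, good u -> good v ->
  all isA u -> all isA v -> centered x -> isF x ->
  phiB' (wprod (u ++ x :: v)) = phiB (wprod u ** wprod v) * phiB' x.2.

Lemma good_AFA u x v : good u -> good v -> all isA u -> all isA v ->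
  centered x -> isF x -> good (u ++ x :: v).
Proof.
move=> gu gv Au Av cx Fx; apply: good_cat => //.
  apply/good_cons; split=> //; case: v Av {gv} => //= y v /andP[Ay _].
  by apply: inl_inr_key; rewrite Fx (negPf Ay).
by move=> y /(allP Au) Ay; apply: inl_inr_key; rewrite Fx (negPf Ay).
Qed.

(** The words are sorted by their number of [F]-letters. With none, [phiB'] and the prescribed value
    are both zero; with one, [target_oneF] identifies the prescribed value; with more, that value is
    zero. *)
Lemma inf_freeP : inf_free phi mulF lact ract Phi fam <->
  [/\ word_free, two_F_vanish & one_F_factor].
Proof.
rewrite inf_free_words; split=> [H|[fr H2 H1] w gw w0].
  have fr : word_free by move=> w gw w0; case: (H w gw w0).
  split=> //.
    move=> w gw c; have [|_ ->] := H w gw; first by case: w c {gw}.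
    exact: target_twoF.
  move=> u x v gu gv Au Av cx Fx.
  have gw := good_AFA gu gv Au Av cx Fx.
  have [|_ ->] := H _ gw; first by case: (u).
  rewrite -[in LHS](revK u) -/(target _) target_oneF ?revK //; first exact: good_rev.
  by rewrite all_rev.
split; first exact: fr.
rewrite -/(target w); case: (ltnP 1 (count isF w)) => [c|].
  by rewrite target_twoF // H2.
rewrite leq_eqVlt ltnS leqn0 => /orP[/eqP c|]; last first.
  rewrite eqn0Ngt -has_count -all_isA => Aw.
  by rewrite target_allA // wprodA //; apply: Phi0.
have /hasP[x xw Fx] : has isF w by rewrite has_count c.
case/splitPr: xw => u v in gw w0 c *.
have Au : all isA u.
  rewrite all_isA has_count; move: c; rewrite count_cat /= Fx; lia.
have Av : all isA v.
  rewrite all_isA has_count; move: c; rewrite count_cat /= Fx; lia.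
have gu := good_catl gw; have /good_cons[cx gv _] := good_catr gw.
rewrite H1 // -[in RHS](revK u) target_oneF ?revK //; first exact: good_rev.
by rewrite all_rev.
Qed.

(** * Cyclic antimonotone and trivial independence in terms of words *)

Definition bprod (s : seq B) : B := foldr (mulB mulF lact ract) one s.

Lemma bprod_cat s t : bprod (s ++ t) = bprod s ** bprod t.
Proof. by elim: s => [|x s IH] /=; rewrite ?mul1B // IH mulBA. Qed.

Lemma mulB_inF f g : ((0, f) : B) ** (0, g) = (0, mulF f g).
Proof. by rewrite /mulB /= mulr0 lact0l ract0 !add0r. Qed.
Lemma mulB_inA a b : ((a, 0) : B) ** (b, 0) = (a * b, 0).
Proof. by rewrite /mulB /= lact0 ract0l mul0F !addr0. Qed.
Lemma mulB_inFA f a : ((0, f) : B) ** (a, 0) = (0, ract f a).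
Proof. by rewrite /mulB /= mul0r lact0 mulF0 add0r addr0. Qed.
Lemma mulB_inAF a f : ((a, 0) : B) ** (0, f) = (0, lact a f).
Proof. by rewrite /mulB /= mulr0 ract0 mul0F !addr0. Qed.

Lemma prodF_bprod (h : nat -> F) m :
  (0, prodF mulF h m) = bprod (mkseq (fun l => (0, h l) : B) m.+1).
Proof.
elim: m => [|m IH]; first by rewrite /= mulB1.
by rewrite mkseqS -cats1 bprod_cat -IH /= mulB1 mulB_inF.
Qed.

(** A pair [(g, c)] stands for the factor [g c], so the list encodes [g_1 c_1 ... g_n c_n]; the
    leading [c_0] is kept apart. *)
Definition alternating_product (s : seq (F * A)) : B :=
  bprod [seq (0, ract y.1 y.2) | y <- s].
Definition F_product (s : seq (F * A)) : B := bprod [seq (0, y.1) | y <- s].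

Lemma alternating_product_cons y s : alternating_product (y :: s) =
  (0, y.1) ** ((y.2, 0) ** alternating_product s).
Proof. by rewrite mulBA mulB_inFA. Qed.

Lemma F_product_cons y s : F_product (y :: s) = (0, y.1) ** F_product s.
Proof. by []. Qed.

(** The last pair [x] is singled out by [rcons] because its coefficient joins [c0] under [phi],
    whereas the coefficients in [s] are the inner ones, each with its own factor. *)
Lemma cyc_antimonotoneP (A0 : A -> Prop) (F0 : F -> Prop) :
  cyc_antimonotone phi mulF lact ract Phi A0 F0 <->
  forall c0 s x, A0 c0 -> (forall y, y \in rcons s x -> F0 y.1 /\ A0 y.2) ->
  phiB' ((c0, 0) ** alternating_product (rcons s x)) =
  phi (c0 * x.2) * (\prod_(y <- s) phi y.2) * phiB' (F_product (rcons s x)).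
Proof.
have eqs (f : nat -> F * A) m c0 :
    phiB' ((c0, 0) ** alternating_product (mkseq f m.+1)) =
      Phi (lact c0 (prodF mulF (fun l => ract (f l).1 (f l).2) m)) /\
    phiB' (F_product (mkseq f m.+1)) = Phi (prodF mulF (fun l => (f l).1) m).
  split; last by rewrite /F_product -map_comp -prodF_bprod.
  by rewrite /alternating_product -map_comp -prodF_bprod mulB_inAF.
split=> [H c0 s x Ac0 sx|H m c g Ac Fg].
  have sE : rcons s x = mkseq (nth x s) (size s).+1.
    by rewrite mkseqS mkseq_nth nth_default.
  have [L R0] := eqs (nth x s) (size s) c0.
  have nthP l : (l <= size s)%N -> F0 (nth x s l).1 /\ A0 (nth x s l).2.
    by move=> ls; apply: sx; rewrite sE; apply: map_f; rewrite mem_iota.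
  (* Lists count from 0, but [c 0] is the leading coefficient and [g] is read from 1 on, hence the
     shift by one. *)
  have := H (size s) (fun l => if l is l'.+1 then (nth x s l').2 else c0)
    (fun l => (nth x s l.-1).1).
  rewrite sE L R0 /= => ->.
  - by rewrite big_add1 /= nth_default // [in RHS](big_nth x).
  - by case=> // l /nthP[].
  - by case=> // l /nthP[].
pose f l := (g l.+1, c l.+1).
have [<- <-] := eqs f m (c 0%N); rewrite mkseqS H.
- by rewrite big_map big_add1 /= /index_iota subn0.
- exact: Ac.
- rewrite -mkseqS => y /mapP[l]; rewrite mem_iota add0n => /andP[_ lm] ->.
  by split; [apply: Fg | apply: Ac].
Qed.

Lemma trivially_independentP : trivially_independent mulF Phi Fj <->
  forall w, good w -> all isF w -> (1 < size w)%N -> phiB' (wprod w) = 0.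
Proof.
split=> [H w gw Fw w1|H m j g m1 jm gm].
  case: w => [//|x0 w] in w1 gw Fw *; set s := x0 :: w in gw Fw *.
  have [kn cn] := good_nth x0 gw.
  have nthE l : (l < size s)%N -> exists j g, nth x0 s l = (inr j, (0, g)) /\ Fj j g.
    move=> ln; apply: centeredF; first exact: cn.
    by apply: (allP Fw); apply: mem_nth.
  have [j0 _] := nthE 0%N isT.
  pose key (k : K) := if k is inr j then j else j0.
  have := H (size w) (fun l => key (nth x0 s l).1) (fun l => (nth x0 s l).2.2).
  rewrite -[Phi _]/(phiB' (0, _)) prodF_bprod => <- //.
  - rewrite -(prodB_nth x0) /prodB /bprod; congr (phiB' (foldr _ _ _)).
    apply/eq_in_map => l; rewrite mem_iota => /andP[_ ln].
    by have [j [g [-> _]]] := nthE l ln.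
  - move=> l ln; have [j [g [E _]]] := nthE _ (ltnW (ln : l.+1 < size s)%N).
    have [j' [g' [E' _]]] := nthE _ (ln : l.+1 < size s)%N.
    by have := kn _ (ln : l.+1 < size s)%N; rewrite E E' /= => ne e; apply: ne; rewrite e.
  - by move=> l ln; have [j [g [-> ?]]] := nthE _ ln.
pose w := mkseq (fun l => (inr (j l) : K, (0, g l) : B)) m.+1.
have gw : good w.
  apply: good_mkseq => l ln; first by move=> [] /jm; apply.
  by apply: centered_inF; apply: gm.
have := H w gw; rewrite /wprod /unzip2 -map_comp -[foldr _ _ _]prodF_bprod size_mkseq.
by apply=> //; apply/allP=> x /mapP[l _ ->].
Qed.

Lemma all_A1 : all_A Ai 1.
Proof. by move=> T [T1 _]. Qed.
Lemma all_A_mul a b : all_A Ai a -> all_A Ai b -> all_A Ai (a * b).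
Proof.
move=> Aa Ab T sT iT; have [_ [_ [_ TM]]] := sT.
by apply: TM; [exact: Aa | exact: Ab].
Qed.
Lemma all_A_lin c a b : all_A Ai a -> all_A Ai b -> all_A Ai (c *: a + b).
Proof.
move=> Aa Ab T sT iT; have [_ [TD [TZ _]]] := sT.
by apply: TD; [apply: TZ; exact: Aa | exact: Ab].
Qed.
Lemma all_A_in i a : Ai i a -> all_A Ai a.
Proof. by move=> ia T _; apply; exists i. Qed.
Lemma all_F_mul f g : all_F mulF Fj f -> all_F mulF Fj g -> all_F mulF Fj (mulF f g).
Proof.
move=> Ff Fg T sT iT; have [_ [_ [_ TM]]] := sT.
by apply: TM; [exact: Ff | exact: Fg].
Qed.
Lemma all_F_in j f : Fj j f -> all_F mulF Fj f.
Proof. by move=> jf T _; apply; exists j. Qed.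

Lemma wprod_allA u : good u -> all isA u ->
  exists2 c, all_A Ai c & wprod u = (c, 0).
Proof.
elim: u => [|x u IH] /=; first by exists 1; first exact: all_A1.
move=> /good_cons[cx gu _] /andP[Ax /IH[//|c Ac cE]].
have [i [a [xE ia _]]] := centeredA cx Ax; exists (a * c).
  by apply: all_A_mul => //; apply: all_A_in ia.
by rewrite wprod_cons cE xE mulB_inA.
Qed.

Lemma wprod_allF x u : good (x :: u) -> all isF (x :: u) ->
  exists2 g, all_F mulF Fj g & wprod (x :: u) = (0, g).
Proof.
elim: u x => [|y u IH] x /good_cons[cx gu _] /andP[Fx Fu];
  have [j [g [xE jg]]] := centeredF cx Fx.
  by exists g; [apply: all_F_in jg | rewrite xE wprod_cons mulB1].
have [f Ff fE] := IH _ gu Fu; exists (mulF g f).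
  by apply: all_F_mul => //; apply: all_F_in jg.
by rewrite wprod_cons fE xE mulB_inF.
Qed.

Lemma first_F (w : seq (K * B)) : has isF w ->
  exists u x v, [/\ w = u ++ x :: v, all isA u & isF x].
Proof.
elim: w => [|y w IH] //=; case: (boolP (isF y)) => [Fy _|Ay /= /IH].
  by exists [::], y, w.
by move=> [u [x [v [-> Au Fx]]]]; exists (y :: u), x, v; rewrite /= /isA Ay.
Qed.

(** * From B'-freeness to the conditions on words *)

Section Forward.
Hypothesis cyc : cyc_antimonotone phi mulF lact ract Phi (all_A Ai) (all_F mulF Fj).
Hypothesis triv : trivially_independent mulF Phi Fj.
Hypothesis fr : word_free.

(** The current pair [(g, c)] absorbs each [A]-letter into [c]; an [F]-letter closes it and opens a
    new pair with coefficient [1]. *)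
Lemma word_alternating g c w : all_F mulF Fj g -> all_A Ai c -> good w ->
  exists s x, (forall y, y \in rcons s x -> all_F mulF Fj y.1 /\ all_A Ai y.2) /\
    (0, g) ** ((c, 0) ** wprod w) = alternating_product (rcons s x).
Proof.
elim: w g c => [|x w IH] g c Fg Ac.
  exists [::], (g, c); split; first by move=> y; rewrite inE => /eqP->.
  by rewrite alternating_product_cons.
move=> /good_cons[cx gw _]; case: (boolP (isF x)) => [Fx|Ax].
  have [j [f [xE jf]]] := centeredF cx Fx.
  have [s [y [sy E]]] := IH f 1 (all_F_in jf) all_A1 gw.
  exists ((g, c) :: s), y; split.
    by move=> z; rewrite rcons_cons inE => /orP[/eqP->|/sy].
  by rewrite rcons_cons alternating_product_cons -E wprod_cons xE -/one mul1B.
have [i [a [xE ia _]]] := centeredA cx Ax.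
have [s [y [sy E]]] := IH g (c * a) Fg (all_A_mul Ac (all_A_in ia)) gw.
by exists s, y; rewrite -E wprod_cons xE [in RHS](mulBA) -mulB_inA -!mulBA.
Qed.

Lemma cyc_sandwich c0 g c : all_A Ai c0 -> all_F mulF Fj g -> all_A Ai c ->
  phiB' ((c0, 0) ** ((0, g) ** (c, 0))) = phi (c0 * c) * Phi g.
Proof.
move=> Ac0 Fg Ac; have := (cyc_antimonotoneP _ _).1 cyc c0 [::] (g, c) Ac0.
rewrite alternating_product_cons F_product_cons !mulB1 big_nil mulr1 => -> //.
by move=> y; rewrite inE => /eqP->.
Qed.

(* [x :: gs] accumulates a run of [F]-letters while scanning the rest [w]. *)
Lemma two_F_vanish_aux u x gs w : good u -> all isA u ->
  good (x :: gs ++ w) -> all isF (x :: gs) -> (gs != [::]) || has isF w ->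
  phiB' (wprod u ** (wprod (x :: gs) ** wprod w)) = 0.
Proof.
move=> gu Au; have [c0 Ac0 ->] := wprod_allA gu Au.
(* No [F]-letter is left after the run: the sandwich formula isolates [Phi] of the run, which has at
   least two letters and so vanishes by trivial independence. *)
have tailA gs' w' : good (x :: gs' ++ w') -> all isF (x :: gs') -> gs' != [::] ->
    all isA w' -> phiB' ((c0, 0) ** (wprod (x :: gs') ** wprod w')) = 0.
  rewrite -cat_cons => gg Fg n0 Aw; have gl := good_catl gg.
  have [c Ac ->] := wprod_allA (good_catr gg) Aw.
  have := (trivially_independentP.1 triv) _ gl Fg.
  have [g Fg' ->] := wprod_allF gl Fg.
  rewrite cyc_sandwich // -[Phi g]/(phiB' (0, g)) => ->; first by rewrite mulr0.
  by case: gs' n0 {gg Fg gl}.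
elim: w gs => [|y w IH] gs gg Fg; first by rewrite orbF => n0; apply: tailA.
case: (boolP (isF y)) => [Fy _|Ay].
  have := IH (rcons gs y); rewrite cat_rcons -rcons_cons all_rcons Fy Fg.
  rewrite -(cats1 (x :: gs)) wprod_cat (wprod_cons y [::]) mulB1 -mulBA; apply=> //.
  by case: (gs).
rewrite /= (negPf Ay) /=; case: (boolP (has isF w)) => [Fw _|]; last first.
  by rewrite orbF -all_isA => Aw n0; apply: tailA => //=; rewrite Aw /isA Ay.
(* Here [y :: v] is the whole gap before the next [F]-letter [z]. It is a nonempty centered word in
   [A], so [phi] of it is zero by freeness, and it enters cyclic antimonotone independence as an
   inner coefficient. *)
have [v [z [t [wE Av Fz]]]] := first_F Fw.
rewrite -cat_cons in gg; have gl := good_catl gg; have gr := good_catr gg.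
have [g Fg' ->] := wprod_allF gl Fg; rewrite wE -cat_cons in gr *.
have gyv := good_catl gr; have Ayv : all isA (y :: v) by rewrite /= Av /isA Ay.
have := fr gyv isT; rewrite wprod_cat; have [c Ac ->] := wprod_allA gyv Ayv.
rewrite /Defs.phiB /= => c_0.
have /good_cons[cz gt _] := good_catr gr.
have [j [f [zE jf]]] := centeredF cz Fz.
have [s [q [sq E]]] := word_alternating (all_F_in jf) all_A1 gt.
rewrite -/one mul1B in E; rewrite wprod_cons zE E.
have := (cyc_antimonotoneP _ _).1 cyc c0 ((g, c) :: s) q Ac0.
rewrite rcons_cons alternating_product_cons => ->.
  by rewrite big_cons c_0 mul0r mulr0 mul0r.
by move=> r; rewrite inE => /orP[/eqP->|/sq].
Qed.

Lemma Bprime_two_F_vanish : two_F_vanish.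
Proof.
move=> w gw c; have [|u [x [v [wE Au Fx]]]] := @first_F w.
  by rewrite has_count; lia.
rewrite {}wE in gw c *; rewrite -cat1s !wprod_cat; apply: two_F_vanish_aux => //.
- exact: good_catl gw.
- exact: good_catr gw.
- by rewrite /= Fx.
by rewrite /= has_count; move: c Au; rewrite all_isA has_count count_cat /= Fx; lia.
Qed.

Lemma Bprime_one_F_factor : one_F_factor.
Proof.
move=> u x v gu gv Au Av cx Fx; rewrite wprod_cat wprod_cons.
have [c0 Ac0 ->] := wprod_allA gu Au; have [c Ac ->] := wprod_allA gv Av.
have [j [g [-> jg]]] := centeredF cx Fx.
by rewrite cyc_sandwich //; apply: all_F_in jg.
Qed.
End Forward.

(** * Words span the generated algebras *)

(** These sets allow concatenation without breaking alternation: a word starting with an [F]-letter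
    can follow any word in [A], and a nonempty word in [A] keeps two words with [F]-letters
    apart. *)
Definition words_headF (p : pred (K * B)) (b : B) : Prop :=
  exists x v, [/\ good (x :: v), all p (x :: v), isF x & b = wprod (x :: v)].
Definition words_nonempty (p : pred (K * B)) (b : B) : Prop :=
  exists x v, [/\ good (x :: v), all p (x :: v) & b = wprod (x :: v)].

Lemma words_headF_sub p y : lspan (words_headF p) y -> lspan (words p) y.
Proof.
apply: lspan_sub => {}y [x [v [gv pv _ ->]]].
by apply: lspan_in; exists (x :: v).
Qed.

Lemma words_one p : lspan (words p) one.
Proof. by apply: lspan_in; exists [::]. Qed.

Lemma inA_lin c (x y : A) : (c *: x + y, 0) = c *: ((x, 0) : B) + (y, 0).
Proof. by congr pair; rewrite /= scaler0 addr0. Qed.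
Lemma inA_add (x y : A) : (x + y, 0) = ((x, 0) : B) + (y, 0).
Proof. by congr pair; rewrite /= addr0. Qed.
Lemma inF_add (x y : F) : (0, x + y) = ((0, x) : B) + (0, y).
Proof. by congr pair; rewrite /= addr0. Qed.
Lemma inA_scale c (x : A) : (c *: x, 0) = c *: ((x, 0) : B).
Proof. by congr pair; rewrite /= scaler0. Qed.
Lemma inF_scale c (x : F) : (0, c *: x) = c *: ((0, x) : B).
Proof. by congr pair; rewrite /= scaler0. Qed.

(** The elements of [A] whose left multiplication preserves the span form a subalgebra, and it
    contains each [Ai i] by [words_lmul]. Closure under products requires [y] to be quantified
    inside the predicate. *)
Lemma all_A_lmul (p : pred (K * B)) a y : (forall i b, p (inl i, b)) ->
  all_A Ai a -> lspan (words p) y -> lspan (words p) ((a, 0) ** y).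
Proof.
move=> pA Aa; move: y; apply: (Aa (fun a => forall y, lspan (words p) y ->
  lspan (words p) ((a, 0) ** y))); last first.
  by move=> b [i ib] y; apply: (@words_lmul p (inl i)).
split; first by move=> y; rewrite -/one mul1B.
split; first by move=> b c Tb Tc y wy; rewrite inA_add mulBDl; apply: lspan_add; auto.
split; first by move=> c b Tb y wy; rewrite inA_scale scaleBl; apply: lspan_scale; auto.
by move=> b c Tb Tc y wy; rewrite -mulB_inA -mulBA; auto.
Qed.

(** The argument is again that suitable left multipliers form a subalgebra, but now the resulting
    words must start with an [F]-letter. *)
Lemma all_F_lmul (p : pred (K * B)) f y : (forall j b, p (inr j, b)) ->
  all_F mulF Fj f -> lspan (words p) y -> lspan (words_headF p) ((0, f) ** y).
Proof.
move=> pF Ff; move: y; apply: (Ff (fun f => forall y, lspan (words p) y ->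
  lspan (words_headF p) ((0, f) ** y))); last first.
  move=> g [j jg] y; elim=> [{}y [w [gw pw] ->]| |c y1 y2 _ IH1 _ IH2]; last first.
  - by rewrite mulB_linr; apply: lspan_lin.
  - by rewrite mulB0; apply: lspan_0.
  have cons h v : Fj j h -> good v -> all p v -> new_key (inr j) v ->
      lspan (words_headF p) ((0, h) ** wprod v).
    move=> jh gv pv kv; apply: lspan_in; exists (inr j, (0, h)), v; split=> //.
      by apply/good_cons; split=> //; apply: centered_inF.
    by rewrite /= pF.
  case: w gw pw => [|x w] gw pw; first exact: cons.
  case: (eqVneq (inr j) x.1) => [jx|jx]; last exact: cons.
  case/good_cons: gw => cx gw xw; case/andP: pw => _ pw.
  have Fx : isF x by rewrite /isF -jx.
  have [j' [h [xE j'h]]] := centeredF cx Fx; rewrite xE /= in jx xw.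
  case: jx => jj'; rewrite -{}jj' in j'h xw.
  (* The product of two letters from the same [Fj j] is again such a letter and is already centered.
     No scalar part splits off, so an [F]-letter remains at the head. *)
  rewrite wprod_cons xE mulBA mulB_inF; apply: cons => //.
  by case: (subF j) => _ [_ [_ SM]]; apply: SM.
split; first by move=> y _; rewrite mul0B; apply: lspan_0.
split; first by move=> g h Tg Th y wy; rewrite inF_add mulBDl; apply: lspan_add; auto.
split; first by move=> c g Tg y wy; rewrite inF_scale scaleBl; apply: lspan_scale; auto.
move=> g h Tg Th y wy; rewrite -mulB_inF -mulBA; apply: Tg.
exact/words_headF_sub/Th.
Qed.

Lemma all_A_span a : all_A Ai a -> lspan (words isA) (a, 0).
Proof. by move=> Aa; rewrite -[(a, 0)]mulB1; apply: all_A_lmul => //; apply: words_one. Qed.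

Lemma all_F_span f : all_F mulF Fj f -> lspan (words_headF isF) (0, f).
Proof. by move=> Ff; rewrite -[(0, f)]mulB1; apply: all_F_lmul => //; apply: words_one. Qed.

(** Freeness makes [phiB] vanish on nonempty words, so the scalar part comes from the empty word
    alone. *)
Lemma words_center (p : pred (K * B)) x : word_free -> lspan (words p) x ->
  exists2 y, lspan (words_nonempty p) y & x = phiB x *: one + y.
Proof.
move=> fr; elim=> [{}x [[|z w] [gw pw] ->]| |c x1 x2 _ [y1 w1 E1] _ [y2 w2 E2]].
- by exists 0; [apply: lspan_0 | rewrite phiB1 scale1r addr0].
- exists (wprod (z :: w)); last by rewrite fr // scale0r add0r.
  by apply: lspan_in; exists z, w.
- by exists 0; [apply: lspan_0 | rewrite phiB0 scale0r addr0].
exists (c *: y1 + y2); first exact: lspan_lin.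
by rewrite phiB_lin scalerDl -scalerA {1}E1 {1}E2 scalerDr addrACA.
Qed.

Definition products (P Q : B -> Prop) (z : B) : Prop :=
  exists a b, [/\ P a, Q b & z = a ** b].

Lemma lspan_mul P Q x y : lspan P x -> lspan Q y -> lspan (products P Q) (x ** y).
Proof.
move=> Px Qy; elim: Px => [a Pa| |c x1 x2 _ IH1 _ IH2]; last first.
- by rewrite mulB_linl; apply: lspan_lin.
- by rewrite mul0B; apply: lspan_0.
elim: Qy => [b Qb| |c y1 y2 _ IH1 _ IH2]; last first.
- by rewrite mulB_linr; apply: lspan_lin.
- by rewrite mulB0; apply: lspan_0.
by apply: lspan_in; exists a, b.
Qed.

Lemma phiB'_lspan0 P x : lspan P x -> (forall y, P y -> phiB' y = 0) -> phiB' x = 0.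
Proof.
move=> Px P0; elim: Px => [y /P0//| |c y z _ y0 _ z0]; first exact: phiB'0.
by rewrite phiB'_lin y0 z0 mulr0 addr0.
Qed.

Lemma good_catAF u x v : good u -> all isA u -> good (x :: v) -> isF x ->
  good (u ++ x :: v).
Proof.
move=> gu Au gv Fx; apply: good_cat => // y /(allP Au) Ay.
by apply: inl_inr_key; rewrite Fx (negPf Ay).
Qed.

Lemma good_catFA u x v : good u -> all isF u -> good (x :: v) -> isA x ->
  good (u ++ x :: v).
Proof.
move=> gu Fu gv Ax; apply: good_cat => // y /(allP Fu) Fy.
by apply: inl_inr_key; rewrite Fy (negPf Ax).
Qed.

(** * From the conditions on words to B'-freeness *)

Section Backward.
Hypothesis fr : word_free.
Hypothesis twoF : two_F_vanish.
Hypothesis oneF : one_F_factor.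

Lemma words_trivially_independent : trivially_independent mulF Phi Fj.
Proof.
apply/trivially_independentP => w gw Fw w1; apply: twoF => //.
by move: Fw; rewrite all_count => /eqP->.
Qed.

(** As [phi c] is zero, [c] is a combination of nonempty words in [A]. These separate the words of
    [g] from those of [g'], so plain concatenation yields good words with at least two
    [F]-letters. *)
Lemma centered_gap_vanish c0 g c g' y :
  all_A Ai c0 -> all_F mulF Fj g -> all_A Ai c -> phi c = 0 -> all_F mulF Fj g' ->
  lspan (words predT) y ->
  phiB' ((c0, 0) ** ((0, g) ** ((c, 0) ** ((0, g') ** y)))) = 0.
Proof.
move=> Ac0 Fg Ac c_0 Fg' wy.
have wc : lspan (words_nonempty isA) (c, 0).
  have [z wz E] := words_center fr (all_A_span Ac).
  by move: wz; rewrite {1}E [phiB _]c_0 scale0r add0r.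
apply: phiB'_lspan0.
  apply: lspan_mul (all_A_span Ac0) _; apply: lspan_mul (all_F_span Fg) _.
  by apply: lspan_mul wc _; apply: all_F_lmul Fg' wy.
move=> q1 [b1 [q2 [[u [gu Au] ->] H ->]]].
case: H => b2 [q3 [[x [v [gv Fv Fx ->]]] H ->]].
case: H => b3 [q4 [[a [t [gt At ->]]] [z [w [gw _ Fz ->]]] ->]].
rewrite -!wprod_cat; apply: twoF.
  apply: good_catAF => //; rewrite -cat_cons; apply: good_catFA => //.
    by rewrite -cat_cons; apply: good_catAF.
  by case/andP: At.
by rewrite !count_cat /= Fx Fz; lia.
Qed.

(** Write [c] as [phi c] times [1] plus a centered element: the latter contributes zero, and the
    scalar lets [g] and [g'] multiply. *)
Lemma gap_factor c0 g c g' y :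
  all_A Ai c0 -> all_F mulF Fj g -> all_A Ai c -> all_F mulF Fj g' ->
  lspan (words predT) y ->
  phiB' ((c0, 0) ** ((0, g) ** ((c, 0) ** ((0, g') ** y)))) =
  phi c * phiB' ((c0, 0) ** ((0, mulF g g') ** y)).
Proof.
move=> Ac0 Fg Ac Fg' wy.
have cE : c = phi c *: 1 + (- phi c *: 1 + c).
  by rewrite addrA -scalerDl subrr scale0r add0r.
rewrite {1}cE inA_lin mulB_linl -/one mul1B !mulB_linr phiB'_lin.
rewrite centered_gap_vanish // ?addr0; first by rewrite -mulB_inF -mulBA.
  by apply: all_A_lin => //; apply: all_A1.
by rewrite phi_lin phi1 mulr1 addNr.
Qed.

(** Both sides are trilinear, so words suffice. If the middle word is a single [F]-letter this is
    [oneF]; if it is longer, both sides vanish by [twoF]. *)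
Lemma sandwich_factor c0 g c : all_A Ai c0 -> all_F mulF Fj g -> all_A Ai c ->
  phiB' ((c0, 0) ** ((0, g) ** (c, 0))) = phi (c0 * c) * Phi g.
Proof.
move=> Ac0 Fg Ac.
suff: forall x y z, lspan (words isA) x -> lspan (words_headF isF) y ->
    lspan (words isA) z -> phiB' (x ** (y ** z)) = phiB (x ** z) * phiB' y.
  by move=> -> //; [apply: all_A_span | apply: all_F_span | apply: all_A_span].
move=> x y z wx wy wz.
elim: wx => [_ [u [gu Au] ->]| |d x1 x2 _ IH1 _ IH2]; last first.
- by rewrite !mulB_linl phiB'_lin phiB_lin IH1 IH2 mulrDl mulrA.
- by rewrite !mul0B phiB'0 phiB0 mul0r.
elim: wz => [_ [v [gv Av] ->]| |d z1 z2 _ IH1 _ IH2]; last first.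
- by rewrite !mulB_linr phiB'_lin phiB_lin IH1 IH2 mulrDl mulrA.
- by rewrite !mulB0 phiB'0 phiB0 mul0r.
elim: wy => [_ [t [w [gw Fw Ft ->]]]| |d y1 y2 _ IH1 _ IH2]; last first.
- by rewrite mulB_linl mulB_linr !phiB'_lin IH1 IH2 mulrDr mulrCA.
- by rewrite mul0B mulB0 phiB'0 mulr0.
case: w gw Fw => [|s w] gw Fw.
  by case/good_cons: gw => ct _ _; rewrite (wprod_cons t [::]) mulB1 -oneF // wprod_cat.
case/and3P: (Fw) => _ Fs _.
rewrite (twoF gw); last by rewrite /= Ft Fs; lia.
rewrite mulr0 -!wprod_cat; apply: twoF; last by rewrite !count_cat /= Ft Fs; lia.
have gwv : good ((t :: s :: w) ++ v).
  case: v gv Av => [|a v] gv Av; first by rewrite cats0.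
  by apply: good_catFA => //; case/andP: Av.
exact: (good_catAF gu Au gwv Ft).
Qed.

Lemma words_cyc_antimonotone :
  cyc_antimonotone phi mulF lact ract Phi (all_A Ai) (all_F mulF Fj).
Proof.
apply/cyc_antimonotoneP => c0 s x Ac0.
have span t : (forall y, y \in t -> all_F mulF Fj y.1 /\ all_A Ai y.2) ->
    lspan (words predT) (alternating_product t).
  elim: t => [|y t IH] ty; first exact: words_one.
  have [Fy Ay] := ty y (mem_head _ _); rewrite alternating_product_cons.
  apply/words_headF_sub/all_F_lmul => //; apply: all_A_lmul => //; apply: IH => z zt.
  by apply: ty; rewrite inE zt orbT.
(* The induction is on length, because closing a gap changes the head of the list and so does not
   produce a sublist. *)
have [n] := ubnP (size s); elim: n s x => // n IH [|y s] x /= sn sx.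
  have [Fx Ax] : all_F mulF Fj x.1 /\ all_A Ai x.2 by apply: sx; rewrite mem_head.
  rewrite alternating_product_cons F_product_cons !mulB1 sandwich_factor //.
  by rewrite big_nil mulr1.
have [Fy Ay] := sx y (mem_head _ _).
have step z t r : (forall q, q \in z :: t -> all_F mulF Fj q.1 /\ all_A Ai q.2) ->
  phiB' ((c0, 0) ** alternating_product ((mulF y.1 z.1, z.2) :: t)) =
    r * phiB' (F_product ((mulF y.1 z.1, z.2) :: t)) ->
  phiB' ((c0, 0) ** alternating_product (y :: z :: t)) =
    phi y.2 * r * phiB' (F_product (y :: z :: t)).
  move=> zt E; have [Fz Az] := zt z (mem_head _ _).
  rewrite !alternating_product_cons gap_factor //; last first.
    apply: all_A_lmul => //; apply: span => q qt.
    by apply: zt; rewrite inE qt orbT.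
  rewrite alternating_product_cons /= in E; rewrite E.
  by rewrite !F_product_cons mulBA mulB_inF mulrA.
(* Closing the gap after [y] turns [y, z] into one pair and shortens the list. *)
have merge z t : (forall q, q \in z :: t -> all_F mulF Fj q.1 /\ all_A Ai q.2) ->
    forall q, q \in (mulF y.1 z.1, z.2) :: t -> all_F mulF Fj q.1 /\ all_A Ai q.2.
  move=> zt q; rewrite inE => /orP[/eqP->|qt]; last by apply: zt; rewrite inE qt orbT.
  have [Fz Az] := zt z (mem_head _ _).
  by split=> //; apply: all_F_mul.
have sx' q : q \in rcons s x -> all_F mulF Fj q.1 /\ all_A Ai q.2.
  by move=> qs; apply: sx; rewrite inE qs orbT.
rewrite big_cons [phi (c0 * _) * _]mulrCA.
case: s sn sx' {sx} => [|z s] /= sn sx'.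
  apply: step => //; rewrite -[[:: _]]/(rcons [::] _) (IH [::]) //.
  exact: merge.
apply: step => //; rewrite -rcons_cons IH //.
  by rewrite !big_cons.
exact: merge.
Qed.
End Backward.

Lemma Bprime_freeP : Bprime_free phi mulF lact ract Phi Ai Fj <->
  inf_free phi mulF lact ract Phi fam.
Proof.
rewrite inf_freeP /Bprime_free /weakly_Bprime_free free_familyP.
split=> [[[fr cyc] triv]|[fr twoF oneF]].
  by split=> //; [apply: Bprime_two_F_vanish | apply: Bprime_one_F_factor].
split; first by split=> //; apply: words_cyc_antimonotone.
exact: words_trivially_independent.
Qed.

End Words.

(** * Part (B) from part (A) *)

Section Reindexing.
Variable R : realType.
Local Notation C := (R[i])%C.
Variables (A : algType C) (F : lmodType C).
Variables (phi : A -> C) (mulF : F -> F -> F).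
Variables (lact : A -> F -> F) (ract : F -> A -> F) (Phi : F -> C).

(** Injectivity of [f] keeps consecutive indices distinct and makes the index sequence symmetric
    exactly when its image is. *)
Lemma inf_free_inj (K K' : Type) (f : K' -> K) (Bk : K -> Bt A F -> Prop)
    (Bk' : K' -> Bt A F -> Prop) :
  injective f -> (forall k x, Bk' k x -> Bk (f k) x) ->
  inf_free phi mulF lact ract Phi Bk -> inf_free phi mulF lact ract Phi Bk'.
Proof.
move=> injf BB' H n k b n0 kn bn pn.
have [] := H n (f \o k) b n0 _ _ pn.
- by move=> l /kn ne /injf.
- by move=> l /bn /BB'.
move=> -> [sym nsym]; split=> //=; split=> [[on ks]|ns].
  by apply: sym; split=> // l /ks /= <-.
by apply: nsym => -[on ks]; apply: ns; split=> // l /ks /injf.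
Qed.

Lemma cyc_antimonotone_sub (A0 : A -> Prop) (F0 F1 : F -> Prop) :
  (forall f, F1 f -> F0 f) ->
  cyc_antimonotone phi mulF lact ract Phi A0 F0 ->
  cyc_antimonotone phi mulF lact ract Phi A0 F1.
Proof. by move=> F10 H m c g Ac Fg; apply: H => // l /Fg/F10. Qed.

Lemma all_F_subalg (J : Type) (Fj : J -> F -> Prop) : subalgF mulF (all_F mulF Fj).
Proof.
split; first by move=> T [].
split.
  move=> x y Fx Fy T sT iT; case: (sT) => _ [TD _].
  by apply: TD; [apply: Fx | apply: Fy].
split; first by move=> c x Fx T sT iT; case: (sT) => _ [_ [TZ _]]; apply: TZ; apply: Fx.
by move=> x y Fx Fy T sT iT; case: (sT) => _ [_ [_ TM]]; apply: TM; [apply: Fx | apply: Fy].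
Qed.

(** With a single index no two neighbours differ, so trivial independence holds vacuously; and
    generating from an algebra that is already generated adds nothing. *)
Lemma weakly_Bprime_free_unit (I J : Type) (Ai : I -> A -> Prop) (Fj : J -> F -> Prop) :
  weakly_Bprime_free phi mulF lact ract Phi Ai Fj <->
  Bprime_free phi mulF lact ract Phi Ai (fun _ : unit => all_F mulF Fj).
Proof.
split=> [[fr cyc]|[[fr cyc] _]].
  split; last by move=> m j g m1 jm; case: (jm 0%N m1); case: (j 0%N) (j 1%N) => [] [].
  split=> //; apply: cyc_antimonotone_sub cyc => f; apply; first exact: all_F_subalg.
  by move=> y [].
split=> //; apply: cyc_antimonotone_sub cyc => f Ff T _; apply.
by exists tt.
Qed.
End Reindexing.

Theorem theorem3p5 (R : realType) (A : algType (R[i])%C) (F : lmodType (R[i])%C)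
  (phi : A -> (R[i])%C) (mulF : F -> F -> F) (lact : A -> F -> F)
  (ract : F -> A -> F) (Phi : F -> (R[i])%C)
  (I J : Type) (Ai : I -> A -> Prop) (Fj : J -> F -> Prop) :
  ncps_typeBprime phi mulF lact ract Phi ->
  (forall i, subalgA (Ai i)) ->
  (forall j, subalgF mulF (Fj j)) ->
  (Bprime_free phi mulF lact ract Phi Ai Fj <->
     inf_free phi mulF lact ract Phi (family_A'F' Ai Fj)) /\
  (weakly_Bprime_free phi mulF lact ract Phi Ai Fj <->
     inf_free phi mulF lact ract Phi (family_A'F'all mulF Ai Fj)).
Proof.
move=> ncps subA subF; split.
  (* Comparing indices needs an equality test, which is classical for [I], [J]. *)
  exact: (@Bprime_freeP _ _ _ _ _ _ _ _ ncps {classic I} {classic J} Ai Fj subA subF).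
rewrite weakly_Bprime_free_unit.
rewrite (@Bprime_freeP _ _ _ _ _ _ _ _ ncps {classic I} unit Ai
  (fun _ => all_F mulF Fj) subA (fun _ => all_F_subalg mulF Fj)).
(* [option I] and [I + unit] index the same subalgebras; the two directions use the two mutually
   inverse relabellings. *)
split; last first.
  apply: (inf_free_inj (f := fun k : I + unit => if k is inl i then Some i else None)).
    by move=> [i|[]] [i'|[]] //= [->].
  by case.
apply: (inf_free_inj (f := fun k : option I => if k is Some i then inl i else inr tt)).
  by move=> [i|] [i'|] //= [->].
by case.
Qed.
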